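(* Let $M$ be a matroid and, for $e\in E(M)$, let $\mathcal{Z}_e=\{A\in\mathcal{Z}(M): e\in A\}$. Assume that for some $x,y\in E(M)$: (i) both $\mathcal{Z}_x-\mathcal{Z}_y$ and $\mathcal{Z}_y-\mathcal{Z}_x$ are nonempty, and (ii) whenever $X\in\mathcal{Z}_x-\mathcal{Z}_y$ and $Y\in\mathcal{Z}_y-\mathcal{Z}_x$, the pair $(X,Y)$ is not modular in $M$. For each $Y\in\mathcal{Z}_y-\mathcal{Z}_x$ let $Y_x=(Y-y)\cup x$, let $$\mathcal{Z}'=(\mathcal{Z}(M)-(\mathcal{Z}_y-\mathcal{Z}_x))\cup\{Y_x: Y\in\mathcal{Z}_y-\mathcal{Z}_x\},$$ and define $r':\mathcal{Z}'\to\mathbb{Z}$ by $r'(A)=r_M(A)$ if $A\in\mathcal{Z}(M)$ and $r'(Y_x)=r_M(Y)$ for $Y\in\mathcal{Z}_y-\mathcal{Z}_x$. Then there is a matroid $M'$ on $E(M)$ whose set of cyclic flats is $\mathcal{Z}'$ and whose rank function agrees with $r'$ on $\mathcal{Z}'$. The matroids $M$ and $M'$ have the same configuration but are not isomorphic. Moreover, $M'$ is isomorphic to the matroid obtained by the same construction with the roles of $x$ and $y$ interchanged.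
   Context: All matroids are finite. A cyclic flat of a matroid $M$ is a flat that is a (possibly empty) union of circuits, equivalently a flat $F$ such that $M|F$ has no coloops; $\mathcal{Z}(M)$ denotes the set of cyclic flats, which is a lattice under inclusion. A pair $(X,Y)$ of subsets of $E(M)$ is modular if $r(X)+r(Y)=r(X\cup Y)+r(X\cap Y)$. Two matroids $M$ and $N$ have the same configuration if $|E(M)|=|E(N)|$ and there is a lattice isomorphism $\Phi:\mathcal{Z}(M)\to\mathcal{Z}(N)$ with $|\Phi(F)|=|F|$ and $r_N(\Phi(F))=r_M(F)$ for all $F\in\mathcal{Z}(M)$. *)

(* Defs.v *)
From mathcomp Require Import all_boot.

Set Implicit Arguments.
Unset Strict Implicit.
Unset Printing Implicit Defensive.

(* The ground set E(M) is the whole of the finite type E. *)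
Record matroid (E : finType) := Matroid {
  rk : {set E} -> nat;
  rk_card : forall A : {set E}, rk A <= #|A|;
  rk_mono : forall A B : {set E}, A \subset B -> rk A <= rk B;
  rk_submod : forall A B : {set E}, rk (A :|: B) + rk (A :&: B) <= rk A + rk B
}.

Section Matroid.
Variables (E : finType) (M : matroid E).
Implicit Types (A B X Y F : {set E}) (x y e : E).

Definition indep A : bool := rk M A == #|A|.

Definition circuits : {set {set E}} :=
  [set C | minset (fun A : {set E} => ~~ indep A) C].

Definition flat F : bool :=
  [forall e, (e \notin F) ==> (rk M F < rk M (e |: F))].

Definition union_of_circuits F : bool :=
  [exists P : {set {set E}}, (P \subset circuits) && (F == cover P)].

Definition cyclic_flats : {set {set E}} :=
  [set F | flat F && union_of_circuits F].

Definition modular_pair X Y : bool :=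
  rk M X + rk M Y == rk M (X :|: Y) + rk M (X :&: Y).

Definition cyclic_flats_at e : {set {set E}} :=
  [set A in cyclic_flats | e \in A].

(* Z_x - Z_y *)
Definition cyclic_flats_diff x y : {set {set E}} :=
  cyclic_flats_at x :\: cyclic_flats_at y.

(* Y_x = (Y - y) \cup x *)
Definition exchange x y Y : {set E} := x |: (Y :\ y).

(* Z' *)
Definition exchanged_flats x y : {set {set E}} :=
  (cyclic_flats :\: cyclic_flats_diff y x)
    :|: [set exchange x y Y | Y in cyclic_flats_diff y x].

End Matroid.

(* r' is given by its two defining clauses, so M' can only satisfy this
   predicate if the clauses are consistent. *)
Definition is_exchange (E : finType) (M : matroid E) (x y : E)
    (M' : matroid E) : Prop :=
  [/\ cyclic_flats M' = exchanged_flats M x y,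
      forall A : {set E}, A \in exchanged_flats M x y ->
        A \in cyclic_flats M -> rk M' A = rk M A
    & forall Y : {set E}, Y \in cyclic_flats_diff M y x ->
        rk M' (exchange x y Y) = rk M Y].

Definition same_configuration (E F : finType) (M : matroid E) (N : matroid F)
    : Prop :=
  #|E| = #|F| /\
  exists Phi : {set E} -> {set F},
    [/\ {in cyclic_flats M &, injective Phi},
        Phi @: cyclic_flats M = cyclic_flats N,
        {in cyclic_flats M &, forall A B : {set E},
           (Phi A \subset Phi B) = (A \subset B)},
        {in cyclic_flats M, forall A : {set E}, #|Phi A| = #|A|}
      & {in cyclic_flats M, forall A : {set E}, rk N (Phi A) = rk M A}].

Definition isomorphic (E F : finType) (M : matroid E) (N : matroid F) : Prop :=
  exists2 f : E -> F, bijective f & forall A : {set E}, rk N (f @: A) = rk M A.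

(* Main.v *)
(* Write [tau] for the transposition of [x] and [y], and [r] for the rank of [M].
   The rank function of [M'] is [min (r A) (r (tau A))] if [x \in A], and
   [max (r A) (r (tau A))] otherwise. Both agree with [r A] unless [A] contains
   exactly one of [x] and [y]. Submodularity can fail only for sets [A], [B]
   containing [x] but not [y] where one minimum is attained by [r A] and the other
   by [r (tau B)]. Since [r A] is the minimum of [r X + #|A - X|] over cyclic flats
   [X], these are witnessed by some [X] in [Z_x - Z_y] and [Y] in [Z_y - Z_x], and
   the nonmodularity of [(X, Y)] provides the missing unit of rank. *)
Require Import Defs.
From mathcomp Require Import all_boot perm zify.

Set Implicit Arguments.
Unset Strict Implicit.
Unset Printing Implicit Defensive.

(** * Rank characterisation of cyclic flats, and the rank as a minimum over them *)

Section RankFunction.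
Variables (E : finType) (M : matroid E).
Implicit Types (A B C F X : {set E}) (e : E).

Lemma rkU_card A B : rk M A <= rk M B + #|A :\: B|.
Proof.
have h1 := rk_submod M B (A :\: B); have h2 := rk_card M (A :\: B).
have h3 : rk M A <= rk M (B :|: A :\: B).
  by apply: rk_mono; apply/subsetP=> z zA; rewrite !inE zA andbT orbN.
lia.
Qed.

Lemma rkD1_le A e : rk M A <= (rk M (A :\ e)).+1.
Proof.
have h := rkU_card A (A :\ e).
suff: #|A :\: (A :\ e)| <= 1 by lia.
rewrite -(cards1 e); apply/subset_leq_card/subsetP=> z.
by rewrite !inE negb_and negbK; case: eqP => //= _; case: (z \in A).
Qed.

(** By submodularity a coloop of [A] stays a coloop of every subset containing it, so the rank of a
    subset grows by one with each element. *)
Lemma rk_coloops A :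
  (forall e, e \in A -> rk M (A :\ e) < rk M A) -> rk M A = #|A|.
Proof.
move=> colA; apply/eqP; rewrite eqn_leq rk_card /=.
suff H n B : #|B| = n -> B \subset A -> n <= rk M B by exact: H (erefl _) _.
elim: n B => // n IHn B cardB sBA.
have /card_gt0P[e eB] : 0 < #|B| by rewrite cardB.
have eA := subsetP sBA e eB.
have h1 := colA e eA.
have h2 := rk_submod M (A :\ e) B.
have h3 : n <= rk M (B :\ e).
  apply: IHn; first by have := cardsD1 e B; rewrite eB; lia.
  exact: subset_trans (subsetDl _ _) sBA.
have h4 : rk M (B :\ e) <= rk M ((A :\ e) :&: B).
  apply: rk_mono; apply/subsetP=> z; rewrite !inE => /andP[-> zB].
  by rewrite zB (subsetP sBA z zB).
have h5 : rk M A <= rk M ((A :\ e) :|: B).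
  by apply: rk_mono; apply/subsetP=> z zA; rewrite !inE zA andbT; case: eqP => // ->.
lia.
Qed.

Lemma circuit_rkD1 C e : C \in circuits M -> e \in C -> rk M (C :\ e) = rk M C.
Proof.
rewrite inE => /minsetP[depC minC] eC.
have ind : rk M (C :\ e) = #|C :\ e|.
  apply/eqP/negPn/negP => dep.
  have := minC _ dep (subsetDl _ _) => /setP/(_ e).
  by rewrite !inE eqxx eC.
have h1 : rk M C < #|C| by rewrite ltn_neqAle depC rk_card.
have h2 : rk M (C :\ e) <= rk M C by apply: rk_mono; exact: subsetDl.
have h3 := cardsD1 e C; rewrite eC in h3; lia.
Qed.

(** A minimal spanning subset [B] of [F :\ e] is independent while [e |: B] is dependent; a circuit
    inside [e |: B] must then use [e]. *)
Lemma ex_circuit F e : e \in F -> rk M (F :\ e) = rk M F ->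
  exists C, [/\ C \in circuits M, C \subset F & e \in C].
Proof.
move=> eF rkF.
pose spans B := (B \subset F :\ e) && (rk M B == rk M F).
have [B /minsetP[/andP[sBF /eqP rkB] minB] _] :
    {B | minset spans B & B \subset F :\ e}.
  by apply: minset_exists; rewrite /spans subxx rkF eqxx.
have indB : rk M B = #|B|.
  apply: rk_coloops => b bB; rewrite rkB ltn_neqAle -{2}rkB rk_mono ?subsetDl //.
  rewrite andbT; apply/negP => h.
  have : spans (B :\ b) by rewrite /spans h (subset_trans (subsetDl _ _) sBF).
  by move/minB => /(_ (subsetDl _ _)) /setP/(_ b); rewrite !inE eqxx bB.
have eB : e \notin B.
  by apply/negP => /(subsetP sBF); rewrite !inE eqxx.
have sBeF : e |: B \subset F.
  by rewrite subUset sub1set eF (subset_trans sBF) // subsetDl.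
have dep : ~~ indep M (e |: B).
  rewrite /indep neq_ltn cardsU1 eB add1n -indB rkB ltnS.
  by rewrite (rk_mono M sBeF).
have [C minC sCB] := minset_exists (P := fun A => ~~ indep M A) dep.
exists C; split; [by rewrite inE | exact: subset_trans sCB sBeF | ].
apply/negPn/negP => eC; have [/negP depC _] := minsetP minC; apply: depC.
have sCB' : C \subset B.
  apply/subsetP => z zC; have := subsetP sCB z zC; rewrite !inE.
  by case/orP=> // /eqP zeq; rewrite zeq (negPf (_ : e \notin C)) // in zC.
rewrite /indep eqn_leq rk_card /=.
have h1 := rkU_card B C; have h2 := cardsD B C.
have h3 : #|B :&: C| = #|C| by congr #|pred_of_set _|; apply/setIidPr.
have h4 := subset_leq_card sCB'; lia.
Qed.

(** Turns the definition by circuits into two rank conditions, the form in which every later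
    argument uses cyclic flats. *)
Lemma cyclic_flatP F :
  reflect ((forall e, e \notin F -> rk M F < rk M (e |: F)) /\
           (forall e, e \in F -> rk M (F :\ e) = rk M F))
          (F \in cyclic_flats M).
Proof.
rewrite inE; apply: (iffP andP) => [[/forallP flF /existsP[P]]|[flF cyF]].
  case/andP=> sP /eqP FP; split=> e eF; first by have := flF e; rewrite eF.
  have /bigcupP[C CP eC] : e \in cover P by rewrite -FP.
  have circC := subsetP sP C CP.
  have sCF : C \subset F by rewrite FP; apply: bigcup_sup.
  have h1 := circuit_rkD1 circC eC.
  (* The union is [F] and the intersection contains [C :\ e], which already has the rank of [C];
     hence [e] is no coloop of [F]. *)
  have h2 := rk_submod M (F :\ e) C.
  have h3 : rk M F <= rk M ((F :\ e) :|: C).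
    by apply: rk_mono; apply/subsetP=> z zF; rewrite !inE zF andbT; case: eqP => // ->.
  have h4 : rk M (C :\ e) <= rk M ((F :\ e) :&: C).
    apply: rk_mono; apply/subsetP=> z; rewrite !inE => /andP[-> zC].
    by rewrite zC (subsetP sCF z zC).
  have h5 : rk M (F :\ e) <= rk M F by apply: rk_mono; exact: subsetDl.
  lia.
split; first by apply/forallP=> e; apply/implyP; exact: flF.
apply/existsP; exists [set C in circuits M | C \subset F]; apply/andP; split.
  by apply/subsetP=> C; rewrite inE => /andP[].
rewrite eqEsubset; apply/andP; split; apply/subsetP=> e.
  move=> eF; have [C [circC sCF eC]] := ex_circuit eF (cyF e eF).
  by apply/bigcupP; exists C; rewrite // inE circC.
by case/bigcupP=> C; rewrite inE => /andP[_ /subsetP/(_ e)].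
Qed.

Lemma rk_cyclic_flat A :
  exists2 X, X \in cyclic_flats M & rk M A = rk M X + #|A :\: X|.
Proof.
pose tight X := rk M X + #|A :\: X| == rk M A.
have tA : tight A by rewrite /tight setDv cards0 addn0.
(* Among the sets attaining the minimum, one of least rank has no coloops, and
   one of largest size with that rank is a flat. *)
have [X /eqP tX minX] := arg_minnP (fun X => rk M X * #|E|.+1 + (#|E| - #|X|)) tA.
exists X => //; apply/cyclic_flatP; split=> e eX.
  rewrite ltnNge; apply/negP=> rkX.
  have cX : #|e |: X| = #|X|.+1 by rewrite cardsU1 eX.
  have cE : #|e |: X| <= #|E| by exact: max_card.
  have h0 := rkU_card A (e |: X).
  have h1 : rk M X <= rk M (e |: X) by apply: rk_mono; exact: subsetUr.
  have h2 : #|A :\: (e |: X)| <= #|A :\: X|.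
    by apply: subset_leq_card; apply: setDS; exact: subsetUr.
  have /minX : tight (e |: X) by rewrite /tight; lia.
  have -> : rk M (e |: X) = rk M X by lia.
  rewrite leq_add2l; lia.
apply/eqP; rewrite eqn_leq rk_mono ?subsetDl //= leqNgt; apply/negP=> rkX.
have h0 := rkU_card A (X :\ e).
have h2 : #|A :\: (X :\ e)| <= #|A :\: X|.+1.
  have h := cardsU1 e (A :\: X).
  have : #|A :\: (X :\ e)| <= #|e |: (A :\: X)|.
    apply: subset_leq_card; apply/subsetP=> z; rewrite !inE.
    by case: eqP => //= _; case: (z \in X).
  by rewrite h; case: (e \notin _) => /=; lia.
have /minX : tight (X :\ e) by rewrite /tight; lia.
have h3 : (rk M (X :\ e)).+1 * #|E|.+1 <= rk M X * #|E|.+1 by rewrite leq_mul2r rkX orbT.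
(* The first term of the weight drops by at least [#|E|.+1], more than the second, at most [#|E|],
   can regain. *)
nia.
Qed.

Lemma in_cyclic_flats_at e A :
  (A \in cyclic_flats_at M e) = (A \in cyclic_flats M) && (e \in A).
Proof. by apply/setIdP/andP. Qed.

End RankFunction.

(** Each rank is bounded above by evaluating [rkU_card] at the cyclic flat that is tight for the
    other. *)
Lemma rk_determined (E : finType) (M N : matroid E) :
  cyclic_flats M = cyclic_flats N ->
  {in cyclic_flats M, rk M =1 rk N} -> rk M =1 rk N.
Proof.
move=> eqZ eqr A; apply/eqP; rewrite eqn_leq; apply/andP; split.
  have [X ZX ->] := rk_cyclic_flat N A; rewrite -eqr ?eqZ //; exact: rkU_card.
have [X ZX ->] := rk_cyclic_flat M A; rewrite eqr //; exact: rkU_card.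
Qed.

Lemma iso_cyclic_flats (E F : finType) (M : matroid E) (N : matroid F)
    (f : E -> F) :
  bijective f -> (forall A : {set E}, rk N (f @: A) = rk M A) ->
  forall A : {set E}, (f @: A \in cyclic_flats N) = (A \in cyclic_flats M).
Proof.
move=> bijf rkf A; have injf := bij_inj bijf; have [g fK gK] := bijf.
have fU e : f @: (e |: A) = f e |: f @: A by rewrite imsetU1.
have fD e : f @: (A :\ e) = f @: A :\ f e.
  by apply/setP=> z; rewrite -(gK z) !inE !mem_imset // !inE inj_eq.
apply/cyclic_flatP/cyclic_flatP => -[fl cy]; split=> e eA.
- by rewrite -!rkf fU; apply: fl; rewrite mem_imset.
- by rewrite -!rkf fD; apply: cy; rewrite mem_imset.
- rewrite -(gK e) -fU !rkf; apply: fl.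
  by rewrite -(mem_imset _ _ injf) gK.
- rewrite -(gK e) -fD !rkf; apply: cy.
  by rewrite -(mem_imset _ _ injf) gK.
Qed.

(** * The transposition of [x] and [y] acting on sets and matroids *)

Section Swap.
Variables (E : finType) (x y : E).
Implicit Types (A B : {set E}) (z : E).

Definition swap A : {set E} := tperm x y @: A.

Lemma in_swap z A : (z \in swap A) = (tperm x y z \in A).
Proof. by rewrite -{1}(tpermK x y z) mem_imset //; exact: perm_inj. Qed.

Lemma swapK : involutive swap.
Proof. by move=> A; apply/setP=> z; rewrite !in_swap tpermK. Qed.

Lemma card_swap A : #|swap A| = #|A|.
Proof. by apply: card_imset; exact: perm_inj. Qed.

Lemma swapS A B : A \subset B -> swap A \subset swap B.
Proof. exact: imsetS. Qed.

Lemma swapU A B : swap (A :|: B) = swap A :|: swap B.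
Proof. exact: imsetU. Qed.

Lemma swapI A B : swap (A :&: B) = swap A :&: swap B.
Proof. by apply/setP=> z; rewrite !(inE, in_swap). Qed.

Lemma swapU1 z A : swap (z |: A) = tperm x y z |: swap A.
Proof. exact: imsetU1. Qed.

Lemma swapD1 z A : swap (A :\ z) = swap A :\ tperm x y z.
Proof.
by apply/setP=> w; rewrite !(inE, in_swap) (can2_eq (tpermK x y) (tpermK x y)).
Qed.

Lemma swap_id A : (x \in A) = (y \in A) -> swap A = A.
Proof. by move=> h; apply/setP=> z; rewrite in_swap; case: tpermP => // ->. Qed.

(** Lets the sets [Y_x] be handled through an involution that preserves sizes and commutes with
    union and intersection. *)
Lemma swap_exchange A : x \notin A -> y \in A -> exchange x y A = swap A.
Proof.
move=> xA yA; apply/setP=> z; rewrite !inE in_swap.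
case: tpermP => [->|->|/eqP zx /eqP zy]; first by rewrite eqxx yA.
- rewrite eqxx (negPf xA) orbF; apply/negP=> /eqP yx.
  by rewrite -yx yA in xA.
- by rewrite (negPf zx) zy.
Qed.

(** The rank of the copy of [M] with [x] and [y] interchanged. This copy has the same [exchange_rk],
    so a one-sided lemma about [M] also yields its mirror image. *)
Definition relabel_rk (M : matroid E) A := rk M (swap A).

Lemma ex_relabel (M : matroid E) : exists N : matroid E, rk N =1 relabel_rk M.
Proof.
have h1 A : relabel_rk M A <= #|A| by rewrite -card_swap; exact: rk_card.
have h2 A B : A \subset B -> relabel_rk M A <= relabel_rk M B.
  by move=> sAB; apply: rk_mono; exact: swapS.
have h3 A B : relabel_rk M (A :|: B) + relabel_rk M (A :&: B)
    <= relabel_rk M A + relabel_rk M B.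
  by rewrite /relabel_rk swapU swapI; exact: rk_submod.
by exists (Matroid h1 h2 h3).
Qed.

End Swap.

Lemma swapC (E : finType) (x y : E) : swap x y =1 swap y x.
Proof. by move=> A; apply/setP=> z; rewrite !in_swap tpermC. Qed.

(** * The exchanged rank function and tight cyclic flats *)

Definition exchange_rk (E : finType) (M : matroid E) (x y : E) (A : {set E}) :=
  if x \in A then minn (rk M A) (rk M (swap x y A))
  else maxn (rk M A) (rk M (swap x y A)).

Section ExchangeRank.
Variables (E : finType) (M : matroid E) (x y : E).
Implicit Types (A B F P Q X Y : {set E}) (e : E).

Lemma in_cyclic_flats_diff X :
  (X \in cyclic_flats_diff M x y) =
  [&& X \in cyclic_flats M, x \in X & y \notin X].
Proof.
rewrite /cyclic_flats_diff /cyclic_flats_at !(in_setD, in_set).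
by case: (flat M X && _) => //=; rewrite andbC.
Qed.

(* Here [y] lies in the closure of [P :\ y], hence in that of [Q :\ y]. *)
Lemma swap_le_sup P Q : y \in P -> x \notin Q -> P \subset Q ->
  rk M P < rk M (swap x y P) -> rk M Q <= rk M (swap x y Q).
Proof.
move=> yP xQ sPQ ltP.
have xP : x \notin P by apply: contra xQ; exact: (subsetP sPQ).
have yQ := subsetP sPQ y yP.
have xy : x != y by apply: contraNneq xP => ->.
have eP : swap x y P :\ x = P :\ y.
  have := swapD1 x y y P; rewrite tpermR => <-.
  by rewrite swap_id // !inE eqxx xy (negPf xP).
have h1 := rkD1_le M (swap x y P) x; rewrite eP in h1.
have h2 := rk_submod M P (Q :\ y).
have h3 : rk M (P :\ y) <= rk M (P :&: (Q :\ y)).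
  apply: rk_mono; apply/subsetP=> z; rewrite !inE => /andP[-> zP].
  by rewrite zP (subsetP sPQ z zP).
have h4 : rk M Q <= rk M (P :|: (Q :\ y)).
  apply: rk_mono; apply/subsetP=> z zQ; rewrite !inE zQ andbT.
  by case: (eqVneq z y) => [->|_]; rewrite ?yP ?orbT.
have h5 : rk M (Q :\ y) <= rk M (swap x y Q).
  apply: rk_mono; apply/subsetP=> z; rewrite !inE in_swap => /andP[zy zQ].
  by rewrite tpermD // eq_sym //; apply: contraNneq xQ => <-.
lia.
Qed.

(** Take any cyclic flat [X] tight for [A]. If [x \in X] forced [y \in X], swapping would not
    enlarge [A :\: X], and [X] would bound the rank of the swapped set by that of [A]. *)
Lemma tight_cyclic_flat_diff A : x \in A -> y \notin A ->
  rk M A < rk M (swap x y A) ->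
  exists2 X, X \in cyclic_flats_diff M x y & rk M A = rk M X + #|A :\: X|.
Proof.
move=> xA yA ltA; have [X ZX rA] := rk_cyclic_flat M A; exists X => //.
rewrite in_cyclic_flats_diff ZX /=.
have h1 := rkU_card M (swap x y A) X.
have h2 : #|A :\: X| < #|swap x y A :\: X| by lia.
suff: ~~ ((x \in X) ==> (y \in X)) by rewrite negb_imply.
apply/negP=> /implyP xyX; move: h2; rewrite ltnNge => /negP; apply.
rewrite -(card_swap x y (_ :\: X)); apply: subset_leq_card.
apply/subsetP=> z; rewrite !(inE, in_swap) tpermK.
case: tpermP => [->|->|//]; last by rewrite (negPf yA) andbF.
by rewrite xA !andbT; apply: contra.
Qed.

End ExchangeRank.

Definition no_modular_diff (E : finType) (M : matroid E) (x y : E) :=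
  forall X Y : {set E},
    X \in cyclic_flats_diff M x y -> Y \in cyclic_flats_diff M y x ->
    ~~ modular_pair M X Y.

Lemma no_modular_diffC (E : finType) (M : matroid E) (x y : E) :
  no_modular_diff M x y -> no_modular_diff M y x.
Proof.
move=> hmod X Y dX dY; have := hmod Y X dY dX.
by rewrite /modular_pair addnC setUC setIC.
Qed.

(** * Rank axioms for the exchanged rank function *)

Section ExchangeMatroid.
Variables (E : finType) (M : matroid E) (x y : E).
Implicit Types (A B F X Y : {set E}) (e : E).

(** Choose [X] tight for [A] and [Y] tight for the swapped [B], and bound the left side through
    [X :|: Y] and [X :&: Y]. The excess sets count at most one element too many, which the strict
    submodularity of [(X, Y)] pays for. *)
Lemma swap_cross_submod A B : no_modular_diff M x y ->
  x \in A -> y \notin A -> x \in B -> y \notin B ->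
  rk M A < rk M (swap x y A) -> rk M (swap x y B) < rk M B ->
  rk M (A :|: B) + rk M (A :&: B) <= rk M A + rk M (swap x y B).
Proof.
move=> hmod xA yA xB yB ltA ltB.
have [X dX rA] := tight_cyclic_flat_diff xA yA ltA.
have [Y dY rB] : exists2 Y, Y \in cyclic_flats_diff M y x &
    rk M (swap x y B) = rk M Y + #|swap x y B :\: Y|.
  apply: tight_cyclic_flat_diff; rewrite ?in_swap ?tpermR ?tpermL //.
  by rewrite (swapC y x) swapK.
have h1 := rk_submod M X Y.
have h2 := hmod X Y dX dY; rewrite /modular_pair in h2.
have h3 := rkU_card M (A :|: B) (X :|: Y).
have h4 := rkU_card M (A :&: B) (X :&: Y).
set U := _ :\: (X :|: Y) in h3; set V := _ :\: (X :&: Y) in h4.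
(* The possible extra element is [x]: it may lie in [V], but it is in neither excess set on the
   right, since [x \in X] and [y \notin B]. *)
have h5 := cardsD1 x V.
have h6 := cardsUI (A :\: X) (swap x y B :\: Y).
have h7 := cardsUI U (V :\ x).
move: dX; rewrite in_cyclic_flats_diff => /and3P[_ xX _].
have swB z : z != x -> z != y -> (z \in swap x y B) = (z \in B).
  by move=> zx zy; rewrite in_swap tpermD // eq_sym.
have h8 : #|U :|: (V :\ x)| <= #|(A :\: X) :|: (swap x y B :\: Y)|.
  apply: subset_leq_card; apply/subsetP=> z; rewrite /U /V !inE.
  case: (eqVneq z x) => [->|zx]; first by rewrite xX.
  case: (eqVneq z y) => [->|zy]; first by rewrite (negPf yA) (negPf yB) /= !andbF.
  rewrite swB //.
  by case: (z \in X); case: (z \in Y); case: (z \in A); case: (z \in B).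
have h9 : #|U :&: (V :\ x)| <= #|(A :\: X) :&: (swap x y B :\: Y)|.
  apply: subset_leq_card; apply/subsetP=> z; rewrite /U /V !inE.
  case: (eqVneq z x) => [->|zx]; first by rewrite xX.
  case: (eqVneq z y) => [->|zy]; first by rewrite (negPf yA) (negPf yB) /= !andbF.
  rewrite swB //.
  by case: (z \in X); case: (z \in Y); case: (z \in A); case: (z \in B).
lia.
Qed.

Lemma exchange_rk_id A : (x \in A) = (y \in A) -> exchange_rk M x y A = rk M A.
Proof. by move=> h; rewrite /exchange_rk swap_id // minnn maxnn if_same. Qed.

Lemma exchange_rk_card A : exchange_rk M x y A <= #|A|.
Proof.
have h1 := rk_card M A; have h2 := rk_card M (swap x y A).
rewrite card_swap in h2; rewrite /exchange_rk; case: ifP => _; lia.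
Qed.

Lemma exchange_rk_mono A B :
  A \subset B -> exchange_rk M x y A <= exchange_rk M x y B.
Proof.
move=> sAB; have h1 := rk_mono M sAB; have h2 := rk_mono M (swapS x y sAB).
have xS := subsetP sAB x; have yS := subsetP sAB y.
rewrite /exchange_rk; case: (boolP (x \in A)) => xA.
  rewrite (xS xA); lia.
case: (boolP (x \in B)) => xB; last lia.
(* Here a maximum for [A] meets a minimum for [B]. The swap fixes [B] if [y \in A], and fixes [A]
   otherwise, so one side has a single value. *)
case: (boolP (y \in A)) => yA.
  rewrite (@swap_id _ x y B) in h2 *; last by rewrite xB yS.
  lia.
rewrite (@swap_id _ x y A) in h2 *; last by rewrite (negPf xA) (negPf yA).
lia.
Qed.

Lemma swap_ltN A : rk M A < rk M (swap x y A) -> (x \in A) = (y \notin A).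
Proof.
move=> ltA; apply: contraTeq ltA; rewrite -leqNgt.
by case: (boolP (x \in A)) => xA; case: (boolP (y \in A)) => yA // _;
  rewrite swap_id // ?xA ?yA // (negPf xA) (negPf yA).
Qed.

Lemma exchange_rk_submod A B : no_modular_diff M x y ->
  exchange_rk M x y (A :|: B) + exchange_rk M x y (A :&: B)
    <= exchange_rk M x y A + exchange_rk M x y B.
Proof.
move=> hmod.
wlog xAB : A B / (x \in B) ==> (x \in A).
  move=> H; case: (boolP ((x \in B) ==> (x \in A))); first exact: H.
  rewrite negb_imply => /andP[xB xA].
  by rewrite setUC setIC addnC [in X in _ <= X]addnC addnC H // (negPf xA).
have h1 := rk_submod M A B.
have h2 := rk_submod M (swap x y A) (swap x y B).
rewrite -swapU -swapI in h2.
set P := A :&: B in h1 h2 *; set Q := A :|: B in h1 h2 *.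
have sPQ : P \subset Q by exact: subset_trans (subsetIl _ _) (subsetUl _ _).
have xP : (x \in P) = (x \in A) && (x \in B) by rewrite inE.
have xQ : (x \in Q) = (x \in A) || (x \in B) by rewrite inE.
have yP : (y \in P) = (y \in A) && (y \in B) by rewrite inE.
have yQ : (y \in Q) = (y \in A) || (y \in B) by rewrite inE.
have swapltN C : rk M (swap x y C) < rk M C -> (x \in C) = (y \notin C).
  rewrite -{2}(swapK x y C) => /swap_ltN; rewrite !in_swap tpermL tpermR => ->.
  by rewrite negbK.
rewrite /exchange_rk xP xQ.
case: (boolP (x \in A)) xAB => xA /=; case: (boolP (x \in B)) => xB //= _.
(* All four values are minima. If those of [A] and [B] are attained on the same side, [h1] or [h2]
   suffices; opposite sides need the nonmodularity. *)
- case: (ltnP (rk M A) (rk M (swap x y A))) => cA;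
  case: (ltnP (rk M (swap x y B)) (rk M B)) => cB; try lia.
    have yA : y \notin A by rewrite -(swap_ltN cA).
    have yB : y \notin B by rewrite -(swapltN B cB).
    have := swap_cross_submod hmod xA yA xB yB cA cB; rewrite -/P -/Q; lia.
  case: (ltnP (rk M (swap x y A)) (rk M A)) => cA'; last lia.
  case: (ltnP (rk M B) (rk M (swap x y B))) => cB'; last lia.
  have yA : y \notin A by rewrite -(swapltN A cA').
  have yB : y \notin B by rewrite -(swap_ltN cB').
  have := swap_cross_submod hmod xB yB xA yA cB' cA'.
  rewrite setUC setIC -/P -/Q; lia.
(* Only [A] contains [x]. The swap fixes both [A] and [Q], or else it fixes [P]; the remaining
   choice of side is then settled by [h1] or [h2]. *)
- case: (boolP (y \in A)) => yA.
    have eA : swap x y A = A by rewrite swap_id // xA yA.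
    have eQ : swap x y Q = Q by rewrite swap_id // xQ yQ xA yA.
    rewrite eA eQ in h2 *; lia.
  have eP : swap x y P = P by rewrite swap_id // xP yP (negPf xB) (negPf yA) andbF.
  rewrite eP in h2 *; lia.
(* All four values are maxima. A strict maximum for [P] on one side forces the maximum for [Q] onto
   that side, so a single submodular inequality suffices. *)
have xQN : x \notin Q by rewrite xQ (negPf xA).
have xPN : x \notin P by rewrite xP (negPf xA).
case: (ltngtP (rk M P) (rk M (swap x y P))) => cP; last lia.
  have yP1 : y \in P by apply/negPn; rewrite -(swap_ltN cP).
  have := swap_le_sup yP1 xQN sPQ cP; lia.
have yP1 : y \in P by apply/negPn; rewrite -(swapltN P cP).
have := @swap_le_sup _ M y x (swap x y P) (swap x y Q).
rewrite !in_swap tpermL tpermR !(swapC y x) !swapK => H.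
have := H yP1 xQN (swapS x y sPQ) cP; lia.
Qed.

Lemma ex_exchange_matroid : no_modular_diff M x y ->
  exists N : matroid E, rk N =1 exchange_rk M x y.
Proof.
move=> hmod; pose sm A B := exchange_rk_submod A B hmod.
by exists (Matroid exchange_rk_card exchange_rk_mono sm).
Qed.
(** The union of [F] with its swap contains [y |: F], of larger rank because [F] is a flat; the
    intersection contains [F :\ x], of full rank because [F] is cyclic. Submodularity then leaves a
    gap. *)
Lemma rk_lt_swap F :
  F \in cyclic_flats_diff M x y -> rk M F < rk M (swap x y F).
Proof.
rewrite in_cyclic_flats_diff => /and3P[/cyclic_flatP[fl cy] xF yF].
have h1 := fl y yF; have h2 := cy x xF.
have h3 := rk_submod M F (swap x y F).
have swF z : z != x -> z != y -> (z \in swap x y F) = (z \in F).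
  by move=> zx zy; rewrite in_swap tpermD // eq_sym.
have h4 : rk M (F :\ x) <= rk M (F :&: swap x y F).
  apply: rk_mono; apply/subsetP=> z; rewrite !inE => /andP[zx zF].
  by rewrite zF swF //; apply: contraNneq yF => <-.
have h5 : rk M (y |: F) <= rk M (F :|: swap x y F).
  apply: rk_mono; rewrite subUset sub1set subsetUl !inE in_swap tpermR xF.
  by rewrite orbT.
lia.
Qed.

Lemma exchange_rk_cyclic_flat F : F \in cyclic_flats M ->
  F \notin cyclic_flats_diff M y x -> exchange_rk M x y F = rk M F.
Proof.
move=> ZF; case: (boolP (F \in cyclic_flats_diff M x y)) => [dF _|].
  have := rk_lt_swap dF; move: dF.
  rewrite in_cyclic_flats_diff /exchange_rk => /and3P[_ -> _]; lia.
rewrite !in_cyclic_flats_diff ZF /= => h1 h2; apply: exchange_rk_id.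
by move: h1 h2; case: (x \in F); case: (y \in F).
Qed.

(** The exchange only permutes the two ranks on the pair [A], [swap x y A]; minimum and maximum
    record this without deciding which set receives which. *)
Lemma exchange_rk_minmax A :
  (minn (exchange_rk M x y A) (exchange_rk M x y (swap x y A))
     = minn (rk M A) (rk M (swap x y A))) *
  (maxn (exchange_rk M x y A) (exchange_rk M x y (swap x y A))
     = maxn (rk M A) (rk M (swap x y A))).
Proof.
case: (eqVneq (x \in A) (y \in A)) => xyA.
  by rewrite (swap_id xyA) exchange_rk_id.
rewrite /exchange_rk swapK in_swap tpermL; move: xyA.
by case: (x \in A); case: (y \in A) => // _; split; lia.
Qed.

(** * Cyclic flats of the exchanged matroid *)

Section CyclicFlats.
Variable N : matroid E.
Hypothesis rkN : rk N =1 exchange_rk M x y.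

(** For a set fixed by the swap, the conditions at [e] and at its image together involve only an
    unordered pair of ranks, which the exchange preserves. *)
Lemma exchange_cyclic_flat_id F : (x \in F) = (y \in F) ->
  (F \in cyclic_flats N) = (F \in cyclic_flats M).
Proof.
move=> xyF; have eF := swap_id xyF.
have mF e : (tperm x y e \in F) = (e \in F) by rewrite -in_swap eF.
have minU e := (exchange_rk_minmax (e |: F)).1.
have minD e := (exchange_rk_minmax (F :\ e)).1.
have geD e := rk_mono M (subsetDl F [set e]).
have geDN e : exchange_rk M x y (F :\ e) <= rk M F.
  by rewrite -(exchange_rk_id xyF) exchange_rk_mono // subsetDl.
have rF := exchange_rk_id xyF.
apply/cyclic_flatP/cyclic_flatP => -[fl cy]; split=> e eF'.
- have := fl e eF'; have := fl (tperm x y e); rewrite mF => /(_ eF').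
  have := minU e; rewrite ?rkN rF swapU1 eF; lia.
- have := cy e eF'; have := cy (tperm x y e); rewrite mF => /(_ eF').
  have := minD e; have := geD e; rewrite ?rkN rF swapD1 eF; lia.
- have := fl e eF'; have := fl (tperm x y e); rewrite mF => /(_ eF').
  have := minU e; rewrite ?rkN rF swapU1 eF; lia.
- have := cy e eF'; have := cy (tperm x y e); rewrite mF => /(_ eF').
  have := minD e; have := geDN e; rewrite ?rkN rF swapD1 eF; lia.
Qed.

(** The sets [x |: F] and [F :\ y] keep their ranks. Were [F] a cyclic flat of [N], these would sum
    to more than twice the maximum defining the rank of [F], against submodularity in [M]. *)
Lemma exchange_cyclic_flat_y F :
  y \in F -> x \notin F -> F \notin cyclic_flats N.
Proof.
move=> yF xF; apply/negP=> /cyclic_flatP[fl cy].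
have := fl x xF; have := cy y yF; rewrite !rkN.
have xy : x != y by apply: contraNneq xF => ->.
rewrite (@exchange_rk_id (x |: F)); last by rewrite !inE eqxx yF orbT.
rewrite (@exchange_rk_id (F :\ y)); last first.
  by rewrite !inE eqxx (negPf xy) (negPf xF).
rewrite /exchange_rk (negPf xF) => h1 h2.
have h3 := rk_submod M F (swap x y F).
have swF z : z != x -> z != y -> (z \in swap x y F) = (z \in F).
  by move=> zx zy; rewrite in_swap tpermD // eq_sym.
have h4 : rk M (F :\ y) <= rk M (F :&: swap x y F).
  apply: rk_mono; apply/subsetP=> z; rewrite !inE => /andP[zy zF].
  by rewrite zF swF //; apply: contraNneq xF => <-.
have h5 : rk M (x |: F) <= rk M (F :|: swap x y F).
  apply: rk_mono; rewrite subUset sub1set subsetUl !inE in_swap tpermL yF.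
  by rewrite orbT.
lia.
Qed.

(** The swapped set has rank at least one more than [F], so neither adding an element nor deleting
    one other than [x] lets the swapped side push the minimum to or below the wrong value. *)
Lemma exchange_cyclic_flat_diff F :
  F \in cyclic_flats_diff M x y -> F \in cyclic_flats N.
Proof.
move=> dF; have lt1 := rk_lt_swap dF.
move: dF; rewrite in_cyclic_flats_diff => /and3P[/cyclic_flatP[fl cy] xF yF].
have xy : y != x by apply: contraNneq yF => ->.
have rF : rk N F = rk M F by rewrite rkN /exchange_rk xF; lia.
apply/cyclic_flatP; split=> e eF; rewrite rF rkN.
  rewrite /exchange_rk !inE xF orbT; have := fl e eF.
  have := rk_mono M (swapS x y (subsetUr [set e] F)); lia.
case: (eqVneq e x) => [->|ex].
  by rewrite exchange_rk_id ?cy // !inE eqxx (negPf yF) andbF.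
rewrite /exchange_rk !inE eq_sym ex xF /= (cy e eF) swapD1.
have := rkD1_le M (swap x y F) (tperm x y e); lia.
Qed.

Lemma cyclic_flat_of_exchange F : x \in F -> y \notin F ->
  rk M F <= rk M (swap x y F) ->
  F \in cyclic_flats N -> F \in cyclic_flats M.
Proof.
move=> xF yF le1 /cyclic_flatP[fl cy].
have rF : rk N F = rk M F by rewrite rkN /exchange_rk xF; lia.
apply/cyclic_flatP; split=> e eF.
  have := fl e eF; rewrite rF rkN /exchange_rk !inE xF orbT; lia.
have := cy e eF; rewrite rF rkN; have := rk_mono M (subsetDl F [set e]).
case: (eqVneq e x) => [->|ex].
  by rewrite exchange_rk_id // !inE eqxx (negPf yF) andbF.
rewrite /exchange_rk !inE eq_sym ex xF /=; lia.
Qed.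

End CyclicFlats.
End ExchangeMatroid.

Lemma exchange_rk_relabel (E : finType) (M N : matroid E) (x y : E) :
  rk N =1 relabel_rk x y M -> exchange_rk N x y =1 exchange_rk M x y.
Proof.
move=> rkN A; rewrite /exchange_rk !rkN /relabel_rk swapK.
by rewrite minnC maxnC.
Qed.

Lemma cyclic_flats_relabel (E : finType) (M N : matroid E) (x y : E) :
  rk N =1 relabel_rk x y M ->
  forall A, (A \in cyclic_flats N) = (swap x y A \in cyclic_flats M).
Proof.
move=> rkN A; apply/esym/iso_cyclic_flats; last by move=> B; rewrite rkN.
exact: (Bijective (tpermK x y) (tpermK x y)).
Qed.

Lemma in_exchanged_flats (E : finType) (M : matroid E) (x y : E) (F : {set E}) :
  (F \in exchanged_flats M x y) =
  (F \in cyclic_flats M :\: cyclic_flats_diff M y x)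
    || (swap x y F \in cyclic_flats_diff M y x).
Proof.
rewrite /exchanged_flats in_setU; congr (_ || _).
have exE (Y : {set E}) :
    Y \in cyclic_flats_diff M y x -> exchange x y Y = swap x y Y.
  by rewrite in_cyclic_flats_diff => /and3P[_ yY xY]; exact: swap_exchange.
apply/imsetP/idP => [[Y dY ->]|dF]; first by rewrite exE // swapK.
by exists (swap x y F); rewrite // exE // swapK.
Qed.

Lemma cyclic_flats_exchange (E : finType) (M N : matroid E) (x y : E) :
  rk N =1 exchange_rk M x y -> cyclic_flats N = exchanged_flats M x y.
Proof.
move=> rkN; apply/setP=> F; rewrite in_exchanged_flats in_setD.
rewrite !in_cyclic_flats_diff !in_swap tpermL tpermR.
case: (eqVneq (x \in F) (y \in F)) => xyF.
  rewrite (exchange_cyclic_flat_id rkN xyF) xyF.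
  by case: (y \in F); rewrite /= ?andbF ?orbF.
case: (boolP (x \in F)) xyF => xF; case: (boolP (y \in F)) => yF //= _.
  (* Passing to the relabelled copy covers the case where the minimum for [F] is attained at its
     swap. *)
  have [M' rkM'] := ex_relabel x y M.
  have rkN' A : rk N A = exchange_rk M' x y A.
    by rewrite (exchange_rk_relabel rkM') rkN.
  rewrite !andbF !andbT /= -(cyclic_flats_relabel rkM').
  apply/idP/orP => [ZF|[ZF|ZF]].
  - case: (leqP (rk M F) (rk M (swap x y F))) => le.
      by left; exact: (cyclic_flat_of_exchange rkN).
    right; apply: (cyclic_flat_of_exchange rkN') => //.
    by rewrite !rkM' /relabel_rk swapK ltnW.
  - by apply: (exchange_cyclic_flat_diff rkN); rewrite in_cyclic_flats_diff ZF xF.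
  - by apply: (exchange_cyclic_flat_diff rkN'); rewrite in_cyclic_flats_diff ZF xF.
rewrite (negPf (exchange_cyclic_flat_y rkN yF xF)).
by case: (F \in _); rewrite /= ?andbF.
Qed.

Lemma is_exchange_of_rk (E : finType) (M N : matroid E) (x y : E) :
  rk N =1 exchange_rk M x y -> is_exchange M x y N.
Proof.
move=> rkN; split; first exact: cyclic_flats_exchange.
  move=> A; rewrite in_exchanged_flats => dA ZA; rewrite rkN.
  apply: exchange_rk_cyclic_flat => //; case/orP: dA; first by rewrite in_setD => /andP[].
  rewrite !in_cyclic_flats_diff !in_swap tpermL tpermR.
  by case/and3P=> _ xA /negPf ->; rewrite andbF.
move=> Y dY; have lt1 := rk_lt_swap dY; move: dY.
rewrite in_cyclic_flats_diff => /and3P[_ yY xY].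
rewrite swap_exchange // rkN /exchange_rk in_swap tpermL yY swapK.
by rewrite swapC in lt1; lia.
Qed.

(** Uniqueness: the constructed matroid has the same cyclic flats with the same ranks, and these
    determine the rank everywhere. *)
Lemma rk_of_is_exchange (E : finType) (M N : matroid E) (x y : E) :
  no_modular_diff M x y -> is_exchange M x y N -> rk N =1 exchange_rk M x y.
Proof.
move=> hmod [ZN r1 r2]; have [N0 rkN0] := ex_exchange_matroid hmod.
have [ZN0 s1 s2] := is_exchange_of_rk rkN0.
move=> A; rewrite -rkN0; move: A; apply: rk_determined; first by rewrite ZN.
move=> F; rewrite ZN => dF; move: (dF); rewrite /exchanged_flats in_setU.
case/orP=> [|/imsetP[Y dY ->]]; last by rewrite r2 // s2.
by rewrite in_setD => /andP[_ ZF]; rewrite r1 // s1.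
Qed.

(** * The isomorphism of lattices of cyclic flats *)

Section Configuration.
Variables (E : finType) (M N : matroid E) (x y : E).
Hypothesis exN : is_exchange M x y N.
Implicit Types (A B P Q : {set E}) (e : E).

Definition exchange_flat A :=
  if A \in cyclic_flats_diff M y x then swap x y A else A.

Lemma cyclic_flats_exchange_flat :
  cyclic_flats N = exchange_flat @: cyclic_flats M.
Proof.
case: exN => -> _ _; apply/setP=> F; rewrite in_exchanged_flats in_setD.
apply/orP/imsetP => [[/andP[dF ZF]|dF]|[A ZA ->]].
- by exists F; rewrite // /exchange_flat (negPf dF).
- exists (swap x y F); last by rewrite /exchange_flat dF swapK.
  by move: dF; rewrite in_cyclic_flats_diff => /andP[].
rewrite /exchange_flat; case: ifPn => dA; first by right; rewrite swapK.
by left; rewrite dA.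
Qed.

(** Such an inclusion would put [P :\ a] inside [Q]. As [a] is no coloop of [P], adding it to [Q]
    would not raise the rank, contrary to [Q] being a flat. *)
Lemma swap_not_subset (a b : E) P Q :
  P \in cyclic_flats_diff M a b -> Q \in cyclic_flats M -> a \notin Q ->
  ~~ (swap a b P \subset Q).
Proof.
rewrite in_cyclic_flats_diff => /and3P[/cyclic_flatP[_ cy] aP bP].
move=> /cyclic_flatP[fl _] aQ; apply/negP=> sPQ.
have h1 := cy a aP; have h2 := fl a aQ; have h3 := rk_submod M P Q.
have h4 : rk M (P :\ a) <= rk M (P :&: Q).
  apply: rk_mono; apply/subsetP=> z; rewrite !inE => /andP[za zP]; rewrite zP.
  apply: (subsetP sPQ); rewrite in_swap tpermD // 1?eq_sym //.
  by apply: contraNneq bP => <-.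
have h5 : rk M (a |: Q) <= rk M (P :|: Q).
  by apply: rk_mono; rewrite subUset sub1set subsetUr !inE aP.
lia.
Qed.

Lemma swap_subset A B : (swap x y A \subset swap x y B) = (A \subset B).
Proof. by apply/idP/idP => /(swapS x y); rewrite ?swapK. Qed.

Lemma exchange_flat_subset : {in cyclic_flats M &, forall A B,
  (exchange_flat A \subset exchange_flat B) = (A \subset B)}.
Proof.
have mixed C : C \in cyclic_flats M -> C \notin cyclic_flats_diff M y x ->
    C \in cyclic_flats_diff M x y \/ swap x y C = C.
  move=> ZC; rewrite !in_cyclic_flats_diff ZC /=.
  case: (eqVneq (x \in C) (y \in C)) => [xyC|]; first by right; exact: swap_id.
  by case: (x \in C); case: (y \in C) => // _ _; left.
move=> A B ZA ZB; rewrite /exchange_flat.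
(* When just one set is moved, the other is either fixed by the swap or contains [x] but not [y]; in
   the latter case both inclusions fail. *)
case: ifPn => dA; case: ifPn => dB //; first exact: swap_subset.
- have [dB'|eB] := mixed B ZB dB; last by rewrite -{1}eB swap_subset.
  move: dB'; rewrite in_cyclic_flats_diff => /and3P[_ xB yB].
  rewrite swapC (negPf (swap_not_subset dA ZB yB)); apply/esym/negP=> sAB.
  move: dA; rewrite in_cyclic_flats_diff => /and3P[_ yA _].
  by rewrite (subsetP sAB y yA) in yB.
have [dA'|eA] := mixed A ZA dA; last by rewrite -{1}eA swap_subset.
move: dB; rewrite in_cyclic_flats_diff => /and3P[_ yB xB].
rewrite -swap_subset swapK (negPf (swap_not_subset dA' ZB xB)).
apply/esym/negP=> sAB; move: dA'; rewrite in_cyclic_flats_diff => /and3P[_ xA _].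
by rewrite (subsetP sAB x xA) in xB.
Qed.

Lemma exchange_flat_inj : {in cyclic_flats M &, injective exchange_flat}.
Proof.
move=> A B ZA ZB eqAB; apply/eqP; rewrite eqEsubset.
by rewrite -(exchange_flat_subset ZA ZB) -(exchange_flat_subset ZB ZA) eqAB subxx.
Qed.

Lemma exchange_same_configuration : same_configuration M N.
Proof.
split=> //; exists exchange_flat; split.
- exact: exchange_flat_inj.
- by rewrite cyclic_flats_exchange_flat.
- exact: exchange_flat_subset.
- by move=> A _; rewrite /exchange_flat; case: ifP => _; rewrite ?card_swap.
move=> A ZA; have [ZN r1 r2] := exN.
rewrite /exchange_flat; case: ifPn => dA.
  rewrite -r2 // swap_exchange //; move: dA;
  by rewrite in_cyclic_flats_diff => /and3P[].
by apply: r1 => //; rewrite in_exchanged_flats in_setD dA ZA.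
Qed.

(** * Counting cyclic flats through an element *)

Lemma card_exchanged_flats_at e :
  #|cyclic_flats_at N e| = #|[set A in cyclic_flats M | e \in exchange_flat A]|.
Proof.
rewrite -[RHS](@card_in_imset _ _ exchange_flat); last first.
  by move=> A B /setIdP[ZA _] /setIdP[ZB _]; exact: exchange_flat_inj.
congr #|pred_of_set _|; apply/setP=> F.
rewrite in_cyclic_flats_at cyclic_flats_exchange_flat.
apply/andP/imsetP => [[/imsetP[A ZA ->] eA]|[A /setIdP[ZA eA] ->]].
  by exists A => //; apply/setIdP.
by split=> //; exact: imset_f.
Qed.

Lemma card_exchanged_flats_at_other e : e != x -> e != y ->
  #|cyclic_flats_at N e| = #|cyclic_flats_at M e|.
Proof.
move=> ex ey; rewrite card_exchanged_flats_at; congr #|pred_of_set _|.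
have te : tperm x y e = e by rewrite tpermD // eq_sym.
have eA A : (e \in exchange_flat A) = (e \in A).
  by rewrite /exchange_flat; case: ifP; rewrite ?in_swap ?te.
by apply/setP=> A; apply/setIdP/setIdP; rewrite eA.
Qed.

(** A flat through [y] alone becomes one through [x], so [x] collects all flats meeting the pair and
    [y] retains those containing both. *)
Lemma card_exchanged_flats_at_x :
  #|cyclic_flats_at N x| = #|cyclic_flats_at M x :|: cyclic_flats_at M y|.
Proof.
rewrite card_exchanged_flats_at; congr #|pred_of_set _|.
apply/setP=> A; rewrite in_setU !in_cyclic_flats_at [LHS]in_set.
rewrite /exchange_flat in_cyclic_flats_diff.
case: (A \in cyclic_flats M) => //=.
by case xA: (x \in A); case yA: (y \in A); rewrite /= ?in_swap ?tpermL ?xA ?yA.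
Qed.

Lemma card_exchanged_flats_at_y :
  #|cyclic_flats_at N y| = #|cyclic_flats_at M x :&: cyclic_flats_at M y|.
Proof.
rewrite card_exchanged_flats_at; congr #|pred_of_set _|.
apply/setP=> A; rewrite in_setI !in_cyclic_flats_at [LHS]in_set.
rewrite /exchange_flat in_cyclic_flats_diff.
case: (A \in cyclic_flats M) => //=.
by case xA: (x \in A); case yA: (y \in A); rewrite /= ?in_swap ?tpermR ?xA ?yA.
Qed.

End Configuration.

Lemma iso_card_cyclic_flats_at (E F : finType) (M : matroid E) (N : matroid F)
    (f : E -> F) :
  bijective f -> (forall A : {set E}, rk N (f @: A) = rk M A) ->
  forall e, #|cyclic_flats_at N (f e)| = #|cyclic_flats_at M e|.
Proof.
move=> bijf rkf e; have injf := bij_inj bijf; have [g fK gK] := bijf.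
rewrite -(card_imset (cyclic_flats_at M e) (imset_inj injf)).
congr #|pred_of_set _|; apply/setP=> A; apply/setIdP/imsetP.
  move=> [ZA eA]; have eqA : A = f @: (g @: A).
    by rewrite -imset_comp -[LHS]imset_id; apply: eq_imset => z /=; rewrite gK.
  exists (g @: A) => //; apply/setIdP; rewrite -(iso_cyclic_flats bijf rkf) -eqA.
  by split=> //; rewrite -(mem_imset _ _ injf) -eqA.
move=> [B /setIdP[ZB eB] ->]; rewrite (iso_cyclic_flats bijf rkf).
by rewrite mem_imset.
Qed.

(* The sum over [e] of [#|Z_e| ^ 2] is an isomorphism invariant. The exchange
   keeps [#|Z_x| + #|Z_y|] but moves the two terms strictly apart. *)
Lemma exchange_not_isomorphic (E : finType) (M N : matroid E) (x y : E) :
  cyclic_flats_diff M x y != set0 -> cyclic_flats_diff M y x != set0 ->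
  is_exchange M x y N -> ~ isomorphic M N.
Proof.
move=> dxy dyx exN [f bijf rkf].
have xy : y != x.
  by apply: contraNneq dxy => ->; rewrite /cyclic_flats_diff setDv.
have eqS : \sum_e #|cyclic_flats_at N e| ^ 2 = \sum_e #|cyclic_flats_at M e| ^ 2.
  rewrite (reindex f) /=; last exact: onW_bij.
  by apply: eq_bigr => e _; rewrite (iso_card_cyclic_flats_at bijf rkf).
have splitS (d : E -> nat) :
    \sum_e d e = d x + (d y + \sum_(e | (e != x) && (e != y)) d e).
  by rewrite (bigD1 x) //= (bigD1 y).
rewrite !splitS in eqS.
rewrite (card_exchanged_flats_at_x exN) (card_exchanged_flats_at_y exN) in eqS.
rewrite (eq_bigr (fun e => #|cyclic_flats_at M e| ^ 2)) in eqS; last first.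
  by move=> e /andP[ex ey]; rewrite (card_exchanged_flats_at_other exN).
rewrite -card_gt0 /cyclic_flats_diff in dxy.
rewrite -card_gt0 /cyclic_flats_diff in dyx.
have h1 := cardsUI (cyclic_flats_at M x) (cyclic_flats_at M y).
have h2 := cardsID (cyclic_flats_at M y) (cyclic_flats_at M x).
have h3 := cardsID (cyclic_flats_at M x) (cyclic_flats_at M y).
(* The two sums of squares differ by twice the product of the sizes of [Z_x - Z_y] and [Z_y - Z_x],
   which is positive. *)
rewrite setIC in h3; nia.
Qed.

Theorem theorem3p1 (E : finType) (M : matroid E) (x y : E)
    (hxy : cyclic_flats_diff M x y != set0)
    (hyx : cyclic_flats_diff M y x != set0)
    (hmod : forall X Y : {set E},
        X \in cyclic_flats_diff M x y -> Y \in cyclic_flats_diff M y x ->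
        ~~ modular_pair M X Y) :
  [/\ exists M' : matroid E, is_exchange M x y M',
      exists M'' : matroid E, is_exchange M y x M''
    & forall M' : matroid E, is_exchange M x y M' ->
        [/\ same_configuration M M',
            ~ isomorphic M M'
          & forall M'' : matroid E, is_exchange M y x M'' ->
              isomorphic M' M'']].
Proof.
have hmod' := no_modular_diffC hmod.
split.
- have [N rkN] := ex_exchange_matroid hmod; exists N; exact: is_exchange_of_rk.
- have [N rkN] := ex_exchange_matroid hmod'; exists N; exact: is_exchange_of_rk.
move=> M' exM'; split; first exact: exchange_same_configuration exM'.
  exact: exchange_not_isomorphic exM'.
(* Both ranks are now explicit. A set contains [x] exactly when its swap contains [y], so both take
   the minimum, or both the maximum, of the same two numbers. *)
move=> M'' exM''; exists (tperm x y).
  exact: (Bijective (tpermK x y) (tpermK x y)).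
move=> A; rewrite -/(swap x y A).
rewrite (rk_of_is_exchange hmod exM') (rk_of_is_exchange hmod' exM'').
rewrite /exchange_rk in_swap tpermR (swapC y x) swapK.
by rewrite minnC maxnC.
Qed.
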